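(* Let $T^\ast:=I_1(x^\ast)$, where $x^\ast\in\Omega=C\cap C_s$ is a local minimizer of $f$ on the restricted feasible set associated with $T^\ast$, i.e. on $\mathcal M_{T^\ast}=\{x\in C:I_1(x)\subseteq T^\ast\}=\{U_{T^\ast}w:w\in C_{T^\ast}\}$. Suppose that there are a neighborhood $\mathcal N$ of $x^\ast$ and constants $0<\mu\le L<\infty$, $\mu_{\rm pg}>0$ such that: (a) (restricted strong convexity) $f$ is twice continuously differentiable and $\mu I\preceq\nabla^2_{T^\ast}f(x)\preceq LI$ for all $x\in\mathcal N$ with $I_1(x)\subseteq T^\ast$; (b) (restricted projected-gradient error bound) for all $x\in\mathcal N$ with $I_1(x)\subseteq T^\ast$, $\|G_L^{T^\ast}(x)\|^2\ge 2\mu_{\rm pg}\big(f(x)-f(x^\ast)\big)$, where $$G_L^{T^\ast}(x):=L\Big[x_{T^\ast}-\operatorname{proj}_{C_{T^\ast}}\big(x_{T^\ast}-\tfrac1L g_{T^\ast}(x)\big)\Big];$$ (c) $\mathcal N$ is chosen sufficiently small so that $f(x)\ge f(x^\ast)$ for all $x\in\mathcal N\cap\mathcal M_{T^\ast}$. Let $\{x^k\}$ be generated by the algorithm RZCW-PSS (described in the context) with the support-identification safeguard imposed in step S1g (constants $\alpha,\delta_{\rm supp}>0$), and with starting point of the main loop satisfying $\|x^0\|_0=s$ and $\min_{i\in I_1(x^0)}|x^0_i|\ge\alpha$. Suppose further that the support on which the iterates eventually stabilize is $T^\ast$ (i.e. $|T^\ast|=s$, and $I_1(x^k)=T^\ast$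 and $\min_{i\in T^\ast}|x^k_i|\ge\alpha$ for all sufficiently large $k$), and that the iterates eventually enter $\mathcal N$; that is, there exists $k_0$ such that $x^k\in\mathcal N$ for all $k\ge k_0$. Assume also that the iterates satisfy $$f(x^{k+1})\le\min_{z\in\Omega^k}f(z)+\xi^k,\qquad \xi^k\le\eta\,\delta^k\ \text{ for some }\eta\in(0,1),\qquad \delta^k:=f(x^k)-\min_{z\in\Omega^k}f(z),$$ and that the following local candidate-richness condition holds: for all sufficiently large $k$ the candidate set $\Omega^k$ contains a point $\bar x^k$ with $f(\bar x^k)\le f(\tilde x^k)$, where $\tilde x^k:=U_{T^\ast}\operatorname{proj}_{C_{T^\ast}}\big(x^k_{T^\ast}-\frac1L g_{T^\ast}(x^k)\big)$. Then there exists a constant $\rho_{\rm lin}\in(0,1)$ such that $$f(x^{k+1})-f(x^\ast)\le(1-\rho_{\rm lin})\big(f(x^k)-f(x^\ast)\big),\qquad\forall k\ge k_0,$$ where one may take $$\rho_{\rm lin}:=\min\Big\{\frac12,\ \frac{(1-\eta)\mu_{\rm pg}}{L}\Big\}.$$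
   Context: Notation. $[n]=\{1,\dots,n\}$; $\|x\|_0$ is the number of nonzero components of $x$; $C_s=\{x\in\mathbb R^n:\|x\|_0\le s\}$; $I_1(x)=\{i:x_i\ne 0\}$, $I_0(x)=\{i:x_i=0\}$. $f:\mathbb R^n\to\mathbb R$ is continuously differentiable, and $g=\nabla f$ is Lipschitz continuous on bounded subsets of $C$. $C\subseteq\mathbb R^n$ is closed, convex, and either nonnegative type-1 symmetric (all vectors of $C$ are componentwise nonnegative and $C$ is invariant under coordinate permutations) or type-2 symmetric (invariant under coordinate permutations and componentwise sign changes); $\Omega=C\cap C_s$. $\operatorname{proj}_S(x)$ denotes a Euclidean nearest point of $S$ to $x$. For $T\subseteq[n]$: $U_T$ is the canonical embedding of $\mathbb R^{|T|}$ into $\mathbb R^n$ on the coordinates $T$, $x_T$ and $g_T(x)$ are the restrictions of $x$ and $g(x)$ to $T$, $\nabla^2_Tf(x)=U_T^\top\nabla^2f(x)U_T$, and $C_T=\{w\in\mathbb R^{|T|}:U_Tw\in C\}$. $\mathbf p(x)=x$ in the nonnegative type-1 case and $\mathbf p(x)=|x|$ (componentwise) in the type-2 case, with components $\mathbf p_i(x)$. A super support of $x\in\Omega$ is a set $\mathcal L\supseteq I_1(x)$ with $|\mathcal L|=s$. ZCW super supports. For $x\in\Omega$ let $Q(x)=\operatorname{argmin}_{q\in I_1(x)}\mathbf p_q(x)$. A ZCW (zero-coordinatewise) super support at $x$ is any set $T=\big(S^\pi_{[\kappa,n]}\cup I_1(x)\cup\{j\}\big)\setminus\{q\}$ with $|T|=s$,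 where $q\in\operatorname{argmin}_{q'\in Q(x)}\mathbf p_{q'}(-g(x))$, $j\in\operatorname{argmin}_{j'\in I_0(x)}\{-\mathbf p_{j'}(-g(x))\}$, $\pi$ is a permutation of $[n]$ sorting $-\mathbf p(-g(x))$ in nonincreasing order, $\kappa\in[n]$, $S^\pi_{[\kappa,n]}=\{\pi(\kappa),\dots,\pi(n)\}$. The algorithm RZCW-PSS. It keeps iterates $x^k\in\Omega$ and a finite reservoir $\mathcal R\subset\Omega$. Initialization (S0): an initial point is projected onto $\Omega$; $\mathcal R$ is filled with projections onto $\Omega$ of finitely many perturbations of it by well-separated directions (pruned by objective value and mutual distance); the best of these points is improved by a basic feasible search (BFS), which repeatedly minimizes $f$ over sets $\{z\in C:I_1(z)\subseteq\mathcal L\}$ for super supports $\mathcal L$; the output is the starting iterate $x^0$ of the main loop. Iteration $k=0,1,2,\dots$: set $\Omega^k:=\{x^k\}$ and insert into $\Omega^k$ finitely many further points of $\Omega$, as follows. (S1a) If $\|x^k\|_0<s$: projections onto $\Omega$ of trial points from one-dimensional searches along coordinate directions. (S1b) If $\|x^k\|_0<s$: subspace candidates $\operatorname{proj}_\Omega(x^k+Ua^\ast)$, where the columns of $U$ are an orthonormal basis of the span of directions $d_\ell$, each obtained from $r^\ell-x^k$, $r^\ell\in\mathcal R$, by keeping only the components in $I_1(x^k)\cup\{j_\ell\}$ for some $j_\ell\in I_0(x^k)$, and $a^\ast$ is an approximate stationary point of $a\mapsto f(x^k+Ua)$ (or a point giving sufficient decrease). (S1c) If $\|x^k\|_0=s$: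 projected results of minimizing $t\mapsto f(x^k+te_i)$ for $i\in I_1(x^k)$, and swap candidates $x^k-x^k_qe_q+x^k_qe_j$ (and $x^k-x^k_qe_q-x^k_qe_j$ if $C$ is type-2 symmetric), with $q,j$ as in the definition of ZCW super supports at $x^k$. (S1d) If $\|x^k\|_0=s$: subspace candidates as in S1b. (S1e) If $\|x^k\|_0=s$: with probability $p^k\in(0,1)$, $\inf_k p^k>0$, a randomly chosen ZCW super support $T^k$ at $x^k$ is generated, a point $r^k\in\Omega$ with $f(r^k)\le\min\{f(z):z\in C,\ I_1(z)\subseteq T^k\}+\varepsilon^k_T$, $\varepsilon_T^k\ge 0$, is computed (the minimum is assumed to be attained), and $r^k$ is inserted into $\Omega^k$ and $\mathcal R$. (S1f) If no sufficient decrease has been generated: optional BFS-refined candidates and fresh well-separated sampled points of $\Omega$. (S1g) With the support-identification safeguard (constants $\alpha,\delta_{\rm supp}>0$), let $$\widehat\Omega^k=\Big\{y\in\Omega^k:\ \|y\|_0=s,\ \min_{i\in I_1(y)}|y_i|\ge\alpha,\ \text{and either } I_1(y)=I_1(x^k)\text{ or } f(x^k)-f(y)\ge\delta_{\rm supp}\Big\};$$ then $x^{k+1}\in\widehat\Omega^k$ is chosen with $f(x^{k+1})\le\min_{z\in\widehat\Omega^k}f(z)+\xi^k$, $\xi^k\ge0$. A new point is accepted only if it decreases $f$ (beyond a numerical tolerance), otherwise $x^{k+1}=x^k$; hence $f(x^{k+1})\le f(x^k)$.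
   Formalization: The neighborhood N is required to be a Euclidean ball around x* (open or closed, possibly infinite radius), and the rate is stated for all k beyond k_0 and beyond the thresholds after which the support is T* and candidate richness holds; the claim fails otherwise. *)

(* Defs.v *)
(* Vectors of R^n are column vectors 'cV[R]_n over a realType; coordinates are
   numbered from 0. *)
From HB Require Import structures.
From mathcomp Require Import all_boot all_order all_fingroup all_algebra.
From mathcomp Require Import all_classical all_reals all_analysis.
Set Implicit Arguments.
Unset Strict Implicit.
Unset Printing Implicit Defensive.
Import Order.TTheory GRing.Theory Num.Theory.
Import numFieldNormedType.Exports.
Local Open Scope classical_set_scope.
Local Open Scope ring_scope.

(* The canonical norm of 'cV[R]_n in the library is the sup norm; it induces the
   same topology, bounded sets and Lipschitz maps, but projections, the
   projected gradient and balls need the Euclidean norm. *)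
Definition enorm (R : realType) (n : nat) (x : 'cV[R]_n) : R :=
  Num.sqrt (\sum_(i < n) x i ord0 ^+ 2).

Definition minimizer_on (R : realType) (A : Type) (S : set A) (F : A -> R)
    (a : A) : Prop :=
  S a /\ forall b, S b -> F a <= F b.

Definition argmin (R : realType) (n : nat) (A : {set 'I_n}) (F : 'I_n -> R) :
    {set 'I_n} :=
  [set i in A | [forall j in A, F i <= F j]].

(* Euclidean nearest points form a set in general; [proj] picks one of them
   (the unique one for a nonempty closed convex set). *)
Definition nearest (R : realType) (n : nat) (S : set 'cV[R]_n)
    (x p : 'cV[R]_n) : Prop :=
  minimizer_on S (fun y => enorm (x - y)) p.

Definition proj (R : realType) (n : nat) (S : set 'cV[R]_n) (x : 'cV[R]_n) :
    'cV[R]_n :=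
  xget 0 [set p | nearest S x p].

Definition supp (R : realType) (n : nat) (x : 'cV[R]_n) : {set 'I_n} :=
  [set i | x i ord0 != 0].

Definition zeros (R : realType) (n : nat) (x : 'cV[R]_n) : {set 'I_n} :=
  [set i | x i ord0 == 0].

Definition norm0 (R : realType) (n : nat) (x : 'cV[R]_n) : nat := #|supp x|.

Definition unitv (R : realType) (n : nat) (i : 'I_n) : 'cV[R]_n :=
  delta_mx i ord0.

Definition grad (R : realType) (n : nat) (f : 'cV[R]_n -> R) (x : 'cV[R]_n) :
    'cV[R]_n :=
  \col_i 'D_(unitv R i) f x.

Definition hess (R : realType) (n : nat) (f : 'cV[R]_n -> R) (x : 'cV[R]_n) :
    'M[R]_n :=
  \matrix_(i, j) 'D_(unitv R j) (fun y => grad f y i ord0) x.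

Definition C1 (R : realType) (n : nat) (f : 'cV[R]_n -> R) : Prop :=
  (forall x, differentiable f x) /\ continuous (grad f).

Definition C2_on (R : realType) (n : nat) (N : set 'cV[R]_n)
    (f : 'cV[R]_n -> R) : Prop :=
  (forall x, N x -> differentiable (grad f) x) /\
  {within N, continuous (hess f)}.

Definition psd (R : realType) (m : nat) (A : 'M[R]_m) : Prop :=
  A^T = A /\ forall v : 'cV[R]_m, 0 <= (v^T *m A *m v) ord0 ord0.

(* Loewner order; as usual it presupposes symmetry, automatic for the Hessian of
   a C^2 function. *)
Definition loewner (R : realType) (m : nat) (A B : 'M[R]_m) : Prop :=
  psd (B - A).

(* The rank-ordered elements of T are the values of enum_val : 'I_#|T| -> 'I_n. *)
Definition embed (R : realType) (n : nat) (T : {set 'I_n}) : 'M[R]_(n, #|T|) :=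
  \matrix_(i, j) (i == enum_val j)%:R.

Definition restr (R : realType) (n : nat) (T : {set 'I_n}) (x : 'cV[R]_n) :
    'cV[R]_#|T| :=
  (embed R T)^T *m x.

Definition hess_restr (R : realType) (n : nat) (T : {set 'I_n})
    (f : 'cV[R]_n -> R) (x : 'cV[R]_n) : 'M[R]_#|T| :=
  (embed R T)^T *m hess f x *m embed R T.

Definition set_restr (R : realType) (n : nat) (T : {set 'I_n})
    (C : set 'cV[R]_n) : set 'cV[R]_#|T| :=
  [set w | C (embed R T *m w)].
Arguments set_restr {R n} T C _.

Definition supported_in (R : realType) (n : nat) (C : set 'cV[R]_n)
    (T : {set 'I_n}) : set 'cV[R]_n :=
  [set x | C x /\ supp x \subset T].

Definition sparse_feasible (R : realType) (n : nat) (C : set 'cV[R]_n)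
    (s : nat) : set 'cV[R]_n :=
  [set x | C x /\ (norm0 x <= s)%N].

(* The projected gradient step with step length 1/L, in the coordinates of T. *)
Definition pg_step (R : realType) (n : nat) (C : set 'cV[R]_n)
    (f : 'cV[R]_n -> R) (L : R) (T : {set 'I_n}) (x : 'cV[R]_n) : 'cV[R]_#|T| :=
  proj (set_restr T C) (restr T x - L^-1 *: restr T (grad f x)).

Definition pg_map (R : realType) (n : nat) (C : set 'cV[R]_n)
    (f : 'cV[R]_n -> R) (L : R) (T : {set 'I_n}) (x : 'cV[R]_n) : 'cV[R]_#|T| :=
  L *: (restr T x - pg_step C f L T x).

(* A Euclidean ball centered at x0, open or closed, of positive and possibly
   infinite radius. Under restricted strong convexity, projected gradient steps
   with step length 1/L do not leave such a neighborhood of a minimizer; they may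
   leave a general, even convex, neighborhood. *)
Definition ball_nbhd (R : realType) (n : nat) (x0 : 'cV[R]_n)
    (N : set 'cV[R]_n) : Prop :=
  nbhs x0 N /\
  forall x y, N x -> enorm (y - x0) <= enorm (x - x0) -> N y.

Inductive symmetry_type := NonnegType1 | Type2.

Definition perm_invariant (R : realType) (n : nat) (C : set 'cV[R]_n) : Prop :=
  forall (sigma : {perm 'I_n}) x, C x -> C (row_perm sigma x).

Definition sign_invariant (R : realType) (n : nat) (C : set 'cV[R]_n) : Prop :=
  forall (e : 'I_n -> bool) x, C x -> C (\col_i ((-1) ^+ e i * x i ord0)).

Definition symmetric_set (ty : symmetry_type) (R : realType) (n : nat)
    (C : set 'cV[R]_n) : Prop :=
  match ty with
  | NonnegType1 => (forall x i, C x -> 0 <= x i ord0) /\ perm_invariant C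
  | Type2 => perm_invariant C /\ sign_invariant C
  end.

Definition symv (ty : symmetry_type) (R : realType) (n : nat) (x : 'cV[R]_n) :
    'cV[R]_n :=
  match ty with
  | NonnegType1 => x
  | Type2 => map_mx (fun t => `|t|) x
  end.

Definition super_support (R : realType) (n s : nat) (x : 'cV[R]_n)
    (Lset : {set 'I_n}) : Prop :=
  supp x \subset Lset /\ #|Lset| = s.

Definition zcw_pair (ty : symmetry_type) (R : realType) (n : nat)
    (f : 'cV[R]_n -> R) (x : 'cV[R]_n) (q j : 'I_n) : Prop :=
  let w := symv ty (- grad f x) in
  let Q := argmin (supp x) (fun i => symv ty x i ord0) in
  q \in argmin Q (fun i => w i ord0) /\
  j \in argmin (zeros x) (fun i => - w i ord0).

Definition zcw_super_support (ty : symmetry_type) (R : realType) (n s : nat)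
    (f : 'cV[R]_n -> R) (x : 'cV[R]_n) (T : {set 'I_n}) : Prop :=
  let w := symv ty (- grad f x) in
  #|T| = s /\
  exists (q j kappa : 'I_n) (pi : {perm 'I_n}),
    [/\ zcw_pair ty f x q j,
        (forall a b : 'I_n, (a <= b)%N ->
           - w (pi b) ord0 <= - w (pi a) ord0) &
        T = ([set pi a | a : 'I_n & (kappa <= a)%N] :|: supp x :|: [set j])
              :\ q].

(* Basic feasible search: finitely many (possibly zero) minimizations of f over
   {z in C : supp z \subset L}, L a super support of the current point. *)
Inductive bfs (R : realType) (n s : nat) (C : set 'cV[R]_n)
    (f : 'cV[R]_n -> R) : 'cV[R]_n -> 'cV[R]_n -> Prop :=
| bfs_stop x : bfs s C f x x
| bfs_step x y z (Lset : {set 'I_n}) :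
    super_support s x Lset ->
    minimizer_on (supported_in C Lset) f y ->
    bfs s C f y z ->
    bfs s C f x z.

Record rzcw_params (R : realType) := RzcwParams {
  alpha : R;            (* support-identification safeguard, with dsupp *)
  dsupp : R;
  tol : R;              (* numerical tolerance of the acceptance test *)
  sep : R;              (* minimal mutual distance of well-separated points *)
  level : R;            (* objective cut-off in the reservoir pruning *)
  prob : nat -> R;      (* the probabilities p^k *)
  eps_stat : nat -> R;  (* accuracy of the subspace stationary points *)
  dec : nat -> R;       (* sufficient decrease *)
  epsT : nat -> R;
  xi : nat -> R
}.

Definition rzcw_params_ok (R : realType) (pr : rzcw_params R) : Prop :=
  [/\ [/\ 0 < alpha pr, 0 < dsupp pr, 0 <= tol pr & 0 < sep pr],
      (forall k, 0 < prob pr k < 1) /\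
      (exists2 c, 0 < c & forall k, c <= prob pr k),
      (forall k, 0 <= eps_stat pr k),
      (forall k, 0 < dec pr k) &
      (forall k, 0 <= epsT pr k) /\ (forall k, 0 <= xi pr k)].

(* One realization of the randomized method: [draw k] is the realized value of
   the uniform variable on [0, 1[ deciding whether the random super-support step
   of iteration k is executed (event [draw k < prob k], of probability p^k).
   [searched k] collects the candidates of iteration k produced before
   [refined k] and [sampled k], which are allowed only after failure. *)
Record rzcw_trace (R : realType) (n : nat) := RzcwTrace {
  iter_ : nat -> 'cV[R]_n;
  reservoir : nat -> seq 'cV[R]_n;
  searched : nat -> seq 'cV[R]_n;
  refined : nat -> seq 'cV[R]_n;
  sampled : nat -> seq 'cV[R]_n;
  draw : nat -> R;
  zcw_set : nat -> {set 'I_n};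
  zcw_point : nat -> 'cV[R]_n
}.

Definition candidates (R : realType) (n : nat) (tr : rzcw_trace R n) (k : nat) :
    seq 'cV[R]_n :=
  iter_ tr k :: searched tr k ++ refined tr k ++ sampled tr k.

(* The minimum of f over the candidates; the starting value f(x^k) of the iterated min is
   harmless since x^k is itself a candidate. *)
Definition cand_min (R : realType) (n : nat) (f : 'cV[R]_n -> R)
    (tr : rzcw_trace R n) (k : nat) : R :=
  \big[Num.min/f (iter_ tr k)]_(z <- candidates tr k) f z.

Definition zcw_drawn (R : realType) (n s : nat) (pr : rzcw_params R)
    (tr : rzcw_trace R n) (k : nat) : bool :=
  (norm0 (iter_ tr k) == s) && (draw tr k < prob pr k).

Definition separated (R : realType) (n : nat) (d : R) (ps : seq 'cV[R]_n) :
    Prop :=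
  forall i j, (i < j < size ps)%N -> d <= enorm (nth 0 ps i - nth 0 ps j).

(* Initialization: [ps] are the projections of the perturbed initial point; a
   pruned point is above the cut-off or too close to a point that is kept. *)
Definition rzcw_init (R : realType) (n s : nat) (C : set 'cV[R]_n)
    (f : 'cV[R]_n -> R) (pr : rzcw_params R) (tr : rzcw_trace R n) : Prop :=
  exists (y0 z0 b : 'cV[R]_n) (ds ps : seq 'cV[R]_n),
  let Om := sparse_feasible C s in
  let R0 := reservoir tr 0%N in
  [/\ nearest Om y0 z0 /\ separated (sep pr) ds,
      size ps = size ds /\
      (forall i, (i < size ds)%N -> nearest Om (z0 + nth 0 ds i) (nth 0 ps i)),
      [/\ {subset R0 <= ps}, separated (sep pr) R0,
          (forall r, r \in R0 -> f r <= level pr) &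
          (forall p, p \in ps ->
             [\/ p \in R0, level pr <= f p |
                 exists2 r, r \in R0 & enorm (p - r) < sep pr])],
      b \in R0 /\ (forall r, r \in R0 -> f b <= f r) &
      bfs s C f b (iter_ tr 0%N)].

Definition coordinate_cand (R : realType) (n s : nat) (C : set 'cV[R]_n)
    (x y : 'cV[R]_n) : Prop :=
  exists (i : 'I_n) (t : R),
    nearest (sparse_feasible C s) (x + t *: unitv R i) y.

Definition mask_vec (R : realType) (n : nat) (A : {set 'I_n}) (d : 'cV[R]_n) :
    'cV[R]_n :=
  \col_i (if i \in A then d i ord0 else 0).

Definition subspace_cand (R : realType) (n s : nat) (C : set 'cV[R]_n)
    (f : 'cV[R]_n -> R) (eps decr : R) (res : seq 'cV[R]_n)
    (x y : 'cV[R]_n) : Prop :=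
  exists (l m : nat) (D : 'M[R]_(n, l)) (U : 'M[R]_(n, m)) (a : 'cV[R]_m),
  [/\ forall c : 'I_l, exists r j,
        [/\ r \in res, j \in zeros x &
            col c D = mask_vec (j |: supp x) (r - x)],
      U^T *m U = 1%:M,
      (U^T == D^T)%MS,
      (* U^T grad f(x + U a) is the gradient of a |-> f(x + U a) *)
      enorm (U^T *m grad f (x + U *m a)) <= eps \/
        f (x + U *m a) <= f x - decr &
      nearest (sparse_feasible C s) (x + U *m a) y].

Definition line_cand (R : realType) (n s : nat) (C : set 'cV[R]_n)
    (f : 'cV[R]_n -> R) (x : 'cV[R]_n) (i : 'I_n) (y : 'cV[R]_n) : Prop :=
  exists2 t : R, minimizer_on setT (fun t => f (x + t *: unitv R i)) t &
    nearest (sparse_feasible C s) (x + t *: unitv R i) y.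

Definition swap_pos (R : realType) (n : nat) (x : 'cV[R]_n) (q j : 'I_n) :
    'cV[R]_n :=
  x - x q ord0 *: unitv R q + x q ord0 *: unitv R j.

Definition swap_neg (R : realType) (n : nat) (x : 'cV[R]_n) (q j : 'I_n) :
    'cV[R]_n :=
  x - x q ord0 *: unitv R q - x q ord0 *: unitv R j.

Definition swap_cand (ty : symmetry_type) (R : realType) (n : nat)
    (f : 'cV[R]_n -> R) (x y : 'cV[R]_n) : Prop :=
  exists q j, zcw_pair ty f x q j /\
    (y = swap_pos x q j \/ (ty = Type2 /\ y = swap_neg x q j)).

Definition searched_kind (ty : symmetry_type) (R : realType) (n s : nat)
    (C : set 'cV[R]_n) (f : 'cV[R]_n -> R) (pr : rzcw_params R)
    (tr : rzcw_trace R n) (k : nat) (y : 'cV[R]_n) : Prop :=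
  let x := iter_ tr k in
  let sub := subspace_cand s C f (eps_stat pr k) (dec pr k) (reservoir tr k) in
  ((norm0 x < s)%N /\ (coordinate_cand s C x y \/ sub x y)) \/
  (norm0 x = s /\
     [\/ exists2 i, i \in supp x & line_cand s C f x i y,
         swap_cand ty f x y,
         sub x y |
         zcw_drawn s pr tr k /\ y = zcw_point tr k]).

(* Candidates that are inserted systematically when ||x^k||_0 = s: the exact
   line minimizations (where the minimum is attained) and the swaps. *)
Definition compulsory_cands (ty : symmetry_type) (R : realType) (n s : nat)
    (C : set 'cV[R]_n) (f : 'cV[R]_n -> R) (tr : rzcw_trace R n) (k : nat) :
    Prop :=
  let x := iter_ tr k in
  norm0 x = s ->
  (forall i, i \in supp x -> (exists y, line_cand s C f x i y) ->
     exists2 y, y \in searched tr k & line_cand s C f x i y) /\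
  ((exists q j, zcw_pair ty f x q j) ->
     exists q j, [/\ zcw_pair ty f x q j, swap_pos x q j \in searched tr k &
                     ty = Type2 -> swap_neg x q j \in searched tr k]).

Definition zcw_step (ty : symmetry_type) (R : realType) (n s : nat)
    (C : set 'cV[R]_n) (f : 'cV[R]_n -> R) (pr : rzcw_params R)
    (tr : rzcw_trace R n) (k : nat) : Prop :=
  let r := zcw_point tr k in
  let T := zcw_set tr k in
  if zcw_drawn s pr tr k then
    [/\ zcw_super_support ty s f (iter_ tr k) T,
        sparse_feasible C s r,
        (exists2 z, minimizer_on (supported_in C T) f z &
                    f r <= f z + epsT pr k),
        r \in searched tr k &
        reservoir tr k.+1 = r :: reservoir tr k]
  else reservoir tr k.+1 = reservoir tr k.

Definition fallback_step (R : realType) (n s : nat) (C : set 'cV[R]_n)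
    (f : 'cV[R]_n -> R) (pr : rzcw_params R) (tr : rzcw_trace R n) (k : nat) :
    Prop :=
  let x := iter_ tr k in
  [/\ (exists2 y, y \in searched tr k & f y <= f x - dec pr k) ->
        refined tr k = [::] /\ sampled tr k = [::],
      forall y, y \in refined tr k ->
        exists2 z, z \in x :: searched tr k ++ sampled tr k & bfs s C f z y &
      separated (sep pr) (sampled tr k)].

Definition safeguarded (R : realType) (n s : nat) (f : 'cV[R]_n -> R)
    (pr : rzcw_params R) (tr : rzcw_trace R n) (k : nat) (y : 'cV[R]_n) : Prop :=
  let x := iter_ tr k in
  [/\ y \in candidates tr k,
      norm0 y = s,
      forall i, i \in supp y -> alpha pr <= `|y i ord0| &
      supp y = supp x \/ dsupp pr <= f x - f y].

Definition selection_step (R : realType) (n s : nat) (f : 'cV[R]_n -> R)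
    (pr : rzcw_params R) (tr : rzcw_trace R n) (k : nat) : Prop :=
  let x := iter_ tr k in
  let x' := iter_ tr k.+1 in
  [/\ safeguarded s f pr tr k x',
      forall z, safeguarded s f pr tr k z -> f x' <= f z + xi pr k &
      x' = x \/ f x' < f x - tol pr].

Definition rzcw_pss (ty : symmetry_type) (R : realType) (n s : nat)
    (C : set 'cV[R]_n) (f : 'cV[R]_n -> R) (pr : rzcw_params R)
    (tr : rzcw_trace R n) : Prop :=
  [/\ rzcw_params_ok pr,
      (forall k, 0 <= draw tr k < 1),
      rzcw_init s C f pr tr,
      (forall k y, y \in candidates tr k \/ y \in reservoir tr k ->
         sparse_feasible C s y) &
      forall k,
        [/\ forall y, y \in searched tr k -> searched_kind ty s C f pr tr k y,
            compulsory_cands ty s C f tr k,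
            zcw_step ty s C f pr tr k,
            fallback_step s C f pr tr k &
            selection_step s f pr tr k]].

(* Main.v *)
(* Write T for the support of xs, x for the current iterate and x~ for its projected
   gradient step on the coordinates in T. The descent lemma and the variational inequality
   of the projection give f(x~) <= f(x) - |G_L^T(x)|^2 / (2 L), provided that the Hessian
   bound holds on the segment [x, x~]. This segment stays in N: since 0 <= H / L <= I there,
   the gradient step of length 1/L is nonexpansive between xs and x, so is the projection,
   and xs is a fixed point of their composition by first-order optimality; hence x~ is not
   farther from xs than x, and N is a ball. The error bound turns the decrease into at least
   the fraction mupg / L of the gap f(x) - f(xs). Some candidate does at least as well
   as x~, and the inexact selection loses at most the fraction eta of its decrease. *)
Require Import Defs.
From HB Require Import structures.
From mathcomp Require Import all_boot all_order all_fingroup all_algebra.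
From mathcomp Require Import all_classical all_reals all_analysis.
From mathcomp Require Import ring lra.
Import Order.TTheory GRing.Theory Num.Theory.
Import numFieldNormedType.Exports.
Local Open Scope classical_set_scope.
Local Open Scope ring_scope.

Set Implicit Arguments.
Unset Strict Implicit.
Unset Printing Implicit Defensive.

(** * Euclidean inner product *)

Section InnerProduct.
Variables (R : realType) (n : nat).
Implicit Types x y z : 'cV[R]_n.

Definition dotv x y : R := (x^T *m y) ord0 ord0.

Lemma dotvE x y : dotv x y = \sum_i x i ord0 * y i ord0.
Proof. by rewrite /dotv mxE; apply: eq_bigr => i _; rewrite mxE. Qed.

Lemma dotvC x y : dotv x y = dotv y x.
Proof. by rewrite !dotvE; apply: eq_bigr => i _; rewrite mulrC. Qed.

Lemma dotvDr x y z : dotv x (y + z) = dotv x y + dotv x z.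
Proof. by rewrite /dotv mulmxDr mxE. Qed.

Lemma dotvDl x y z : dotv (x + y) z = dotv x z + dotv y z.
Proof. by rewrite dotvC dotvDr !(dotvC z). Qed.

Lemma dotvZr a x y : dotv x (a *: y) = a * dotv x y.
Proof. by rewrite /dotv -scalemxAr mxE. Qed.

Lemma dotvZl a x y : dotv (a *: x) y = a * dotv x y.
Proof. by rewrite dotvC dotvZr dotvC. Qed.

Lemma dotvNr x y : dotv x (- y) = - dotv x y.
Proof. by rewrite -scaleN1r dotvZr mulN1r. Qed.

Lemma dotvNl x y : dotv (- x) y = - dotv x y.
Proof. by rewrite dotvC dotvNr dotvC. Qed.

(** Expanding with these rules leaves inequalities that are linear in the remaining inner products,
    the form handled by [lra]. *)
Definition dotv_lin := (dotvDr, dotvDl, dotvNr, dotvNl, dotvZr, dotvZl).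

Lemma dotv_ge0 x : 0 <= dotv x x.
Proof. by rewrite dotvE sumr_ge0 // => i _; rewrite -expr2 sqr_ge0. Qed.

Lemma enorm_sqr x : enorm x ^+ 2 = dotv x x.
Proof.
rewrite /enorm dotvE sqr_sqrtr; first by apply: eq_bigr => i _; rewrite expr2.
by rewrite sumr_ge0 // => i _; rewrite sqr_ge0.
Qed.

Lemma enorm_ge0 x : 0 <= enorm x.
Proof. exact: sqrtr_ge0. Qed.

Lemma ler_enorm x y : (enorm x <= enorm y) = (dotv x x <= dotv y y).
Proof. by rewrite -!enorm_sqr ler_sqr ?nnegrE ?enorm_ge0. Qed.

End InnerProduct.

Lemma dotv_mulmx (R : realType) m n (A : 'M[R]_(n, m)) (x : 'cV_m) (y : 'cV_n) :
  dotv (A *m x) y = dotv x (A^T *m y).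
Proof. by rewrite /dotv trmx_mul mulmxA. Qed.

(** * Existence and variational inequality of nearest points *)

Section NearestPoint.
Variables (R : realType) (n : nat).
Implicit Types (A : set 'cV[R]_n) (x y p : 'cV[R]_n).

Lemma continuous_mx (T : topologicalType) (m k : nat) (F : T -> 'M[R]_(m, k)) :
  (forall i j, continuous (fun t => F t i j)) -> continuous F.
Proof.
move=> cF t S [P PF sP].
have : \forall u \near t, forall i j, P i j (F u i j).
  by apply: filter_forall => i; apply: filter_forall => j; exact: cF (PF i j).
by apply: filterS => u; exact: sP.
Qed.

Lemma continuous_dotv_sub x : continuous (fun y => dotv (x - y) (x - y)).
Proof.
move=> y; apply: differentiable_continuous.
have -> : (fun y => dotv (x - y) (x - y)) =
    \sum_i (fun y : 'cV[R]_n => (x i ord0 - y i ord0) ^+ 2).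
  apply/funext => z; rewrite dotvE fct_sumE.
  by apply: eq_bigr => i _; rewrite !mxE expr2.
apply: differentiable_sum => i.
have d : differentiable (fun z : 'cV[R]_n => x i ord0 - z i ord0) y.
  by apply: differentiableB => //; exact: differentiable_coord.
exact: (differentiableM d d).
Qed.

(** Only the points of [A] no farther from [x] than some [a] in [A] matter; they form a compact set,
    on which the squared distance attains its minimum. Row vectors match the form of
    [bounded_closed_compact]. *)
Lemma nearest_exists A x : closed A -> A !=set0 -> exists p, nearest A x p.
Proof.
move=> Acl [a Aa].
pose d (y : 'cV[R]_n) := dotv (x - y) (x - y).
pose K : set 'rV[R]_n := [set v | A v^T /\ d v^T <= d a].
have tr_cont : continuous (fun v : 'rV[R]_n => v^T).
  apply: continuous_mx => i j.
  rewrite [X in continuous X](_ : _ = fun v : 'rV[R]_n => v j i).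
    exact: coord_continuous.
  by apply/funext => v; rewrite mxE.
have d_cont : continuous (fun v : 'rV[R]_n => d v^T).
  by move=> v; exact: (continuous_comp (tr_cont v) (@continuous_dotv_sub x _)).
have Kcl : closed K.
  have -> : K = (fun v => v^T) @^-1` A `&`
      (fun v => d v^T) @^-1` [set t | t <= d a] by [].
  apply: closedI; first by apply: preimage_closed => // v _; exact: tr_cont.
  by apply: preimage_closed; [move=> v _; exact: d_cont | exact: closed_le].
have Kbd : bounded_set K.
  (* This bounds the sup norm on [K]: |v_j| <= |x_j| + |x_j - v_j|, and the last term is at most
     [enorm (x - v)], hence at most [enorm (x - a)]. *)
  exists (\big[Num.max/0]_i `|x i ord0| + enorm (x - a)); split; first exact: num_real.
  move=> M /ltW MgeM v [_ dv]; apply: le_trans MgeM.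
  rewrite [leLHS]/Num.norm /= mx_normrE; apply/bigmax_leP; split=> /=.
    by rewrite addr_ge0 ?enorm_ge0 //; apply: bigmax_ge_id.
  move=> [i j] _ /=; rewrite ord1.
  rewrite -[v 0 j](subKr (x j ord0)).
  apply: (le_trans (ler_normB _ _)); apply: lerD.
    exact: (le_bigmax _ (fun i => `|x i ord0|)).
  move: dv; rewrite /d -ler_enorm; apply: le_trans.
  rewrite -ler_sqr ?nnegrE ?enorm_ge0 //.
  rewrite enorm_sqr dotvE (bigD1 j) //= !mxE real_normK ?num_real // expr2 lerDl.
  by apply: sumr_ge0 => k _; rewrite -expr2 sqr_ge0.
have K0 : K !=set0 by exists a^T; split; rewrite trmxK.
have [c cK cmin] := compact_EVT_min K0 (bounded_closed_compact Kbd Kcl)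
    (continuous_subspaceT d_cont).
move: cK; rewrite inE => -[Ac dc].
exists c^T; split => // b Ab; rewrite ler_enorm -!/(d _).
case: (leP (d b) (d a)) => [ba|/ltW ab]; last exact: le_trans dc ab.
by rewrite -[in leRHS](trmxK b); apply: cmin; rewrite inE; split; rewrite trmxK.
Qed.

Lemma proj_nearest A x : closed A -> A !=set0 -> nearest A x (Defs.proj A x).
Proof.
move=> Acl A0; have [p np] := nearest_exists x Acl A0.
exact: (@xgetPex _ 0 [set p | nearest A x p] (ex_intro _ p np)).
Qed.

(** Convexity with a plain real parameter; this form passes directly to [set_restr T C] through the
    linear map [embed R T]. *)
Definition segment_closed A :=
  forall x y (t : R), A x -> A y -> 0 <= t <= 1 -> A (x + t *: (y - x)).

Lemma segment_closed_convex A : convex_set A -> segment_closed A.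
Proof.
move=> cA x y t Ax Ay /andP[t0 t1].
have := cA y x (Itv01 t0 t1); rewrite !inE => /(_ Ay Ax).
suff -> : conv (Itv01 t0 t1) (y : convex_lmodType _) x = x + t *: (y - x) by [].
rewrite scalerBr addrCA -[X in _ = _ + (X - _)]scale1r -scalerBl.
by [].
Qed.

Lemma nearest_variational A x p y :
  segment_closed A -> nearest A x p -> A y -> dotv (x - p) (y - p) <= 0.
Proof.
move=> sA [Ap pmin] Ay; rewrite leNgt; apply/negP.
set u := x - p; set v := y - p => a0.
have b0 : 0 <= dotv v v by exact: dotv_ge0.
(* the squared distance [|u|^2 - 2 t <u, v> + t^2 |v|^2] from [x] to [p + t v] drops below
   its value at [t = 0] for this [t] *)
pose t := dotv u v / (dotv u v + dotv v v).
have ab0 : 0 < dotv u v + dotv v v by rewrite ltr_wpDr.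
have t0 : 0 < t by rewrite divr_gt0.
have t1 : t <= 1 by rewrite ler_pdivrMr // mul1r lerDl.
have tab : t * (dotv u v + dotv v v) = dotv u v by rewrite divfK ?gt_eqF.
have := pmin _ (sA _ _ t Ap Ay _); rewrite (ltW t0) t1 => /(_ isT).
rewrite ler_enorm opprD addrA -/u -/v; clearbody u v.
rewrite !dotv_lin (dotvC v u).
have := mulr_gt0 t0 a0.
(* Hence the squared distance changes by at most - t <u, v> < 0, against the minimality of [p]. *)
have : t * (t * dotv v v) <= t * dotv u v.
  by rewrite ler_pM2l // -[leRHS]tab ler_pM2l // lerDr ltW.
lra.
Qed.

End NearestPoint.

(** * Derivatives along lines, mean value and descent inequalities *)

Section DirectionalDerivative.
Variables (R : realType) (n : nat).
Implicit Types (x y d v : 'cV[R]_n) (f : 'cV[R]_n -> R).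

Lemma cV_sum_unitv d : d = \sum_i d i ord0 *: unitv R i.
Proof.
apply/colP => i; rewrite summxE (bigD1 i) //= !mxE !eqxx mulr1.
rewrite big1 ?addr0 // => j ji.
by rewrite !mxE eq_sym (negbTE ji) mulr0.
Qed.

Lemma derive_grad f x d : differentiable f x -> 'D_d f x = dotv (grad f x) d.
Proof.
move=> df; rewrite deriveE // {1}(cV_sum_unitv d) linear_sum dotvE.
by apply: eq_bigr => i _; rewrite linearZ /= -deriveE // mxE mulrC.
Qed.

Lemma is_derive_line f x d (t : R) :
  differentiable f (x + t *: d) ->
  is_derive t 1 (fun t => f (x + t *: d)) (dotv (grad f (x + t *: d)) d).
Proof.
move=> df; rewrite -derive_grad //.
have E : (fun h : R => h^-1 *: (((fun t => f (x + t *: d)) \o shift t) (h *: 1)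
            - f (x + t *: d))) =
         (fun h : R => h^-1 *: ((f \o shift (x + t *: d)) (h *: d)
            - f (x + t *: d))).
  apply/funext => h /=; congr (_ *: (f _ - _)).
  by rewrite [h%:A]mulr1 scalerDl addrCA.
apply: DeriveDef; last by rewrite /derive E.
by rewrite /derivable E; exact: (@diff_derivable _ _ _ f (x + t *: d) d).
Qed.

Lemma differentiable_dotv (F : 'cV[R]_n -> 'cV[R]_n) x v :
  differentiable F x -> differentiable (fun y => dotv (F y) v) x.
Proof.
move=> dF.
have -> : (fun y => dotv (F y) v) =
    \sum_i (fun y : 'cV[R]_n => F y i ord0 * v i ord0).
  by apply/funext => z; rewrite dotvE fct_sumE.
apply: differentiable_sum => i.
apply: differentiableM => //.
exact: (differentiable_comp dF (differentiable_coord _ i ord0)).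
Qed.

(** Entry j is the sum over i of H_ij v_i, whence the transpose. It cancels when the product with a
    direction is taken, so no symmetry of the Hessian is invoked. *)
Lemma grad_dotv_grad f x v : differentiable (grad f) x ->
  grad (fun y => dotv (grad f y) v) x = (hess f x)^T *m v.
Proof.
move=> dg; apply/colP => j; rewrite !mxE.
have -> : (fun y => dotv (grad f y) v) =
    \sum_i (fun y : 'cV[R]_n => grad f y i ord0 * v i ord0).
  by apply/funext => z; rewrite dotvE fct_sumE.
have dgi i : derivable (fun y => grad f y i ord0) x (unitv R j).
  apply: diff_derivable.
  exact: (differentiable_comp dg (differentiable_coord _ i ord0)).
rewrite derive_sum; last first.
  by move=> i; apply: derivableM => //; exact: derivable_cst.
apply: eq_bigr => i _; rewrite !mxE deriveM //=.
by rewrite derive_cst scaler0 add0r [LHS]mulrC.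
Qed.

Lemma is_derive_grad_line f x d v (t : R) :
  differentiable (grad f) (x + t *: d) ->
  is_derive t 1 (fun t => dotv (grad f (x + t *: d)) v)
    (dotv v (hess f (x + t *: d) *m d)).
Proof.
move=> dg.
have := @is_derive_line (fun y => dotv (grad f y) v) x d t (differentiable_dotv v dg).
by rewrite grad_dotv_grad // dotv_mulmx trmxK.
Qed.

Lemma is_derive1_continuous (h dh : R -> R) (A : set R) :
  (forall t : R, t \in A -> is_derive t 1 h (dh t)) -> {within A, continuous h}.
Proof.
move=> H; apply: continuous_in_subspaceT => t tA.
by have Ht := H t tA; apply/differentiable_continuous/derivable1_diffP.
Qed.

(** The scalar mean value theorem applied to t |-> <grad f(x + t d), v>; the intermediate [c]
    depends on [v]. *)
Lemma grad_mean_value f x d v :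
  (forall t : R, 0 <= t <= 1 -> differentiable (grad f) (x + t *: d)) ->
  exists2 c : R, 0 <= c <= 1 &
    dotv (grad f (x + d) - grad f x) v = dotv v (hess f (x + c *: d) *m d).
Proof.
move=> dg.
have H (t : R) : t \in `[0, 1] -> is_derive t 1 (fun t => dotv (grad f (x + t *: d)) v)
    (dotv v (hess f (x + t *: d) *m d)).
  by rewrite in_itv /= => /dg; exact: is_derive_grad_line.
have Hc : {within `[0, 1], continuous (fun t : R => dotv (grad f (x + t *: d)) v)}.
  by apply: is_derive1_continuous => t; rewrite inE /=; exact: H.
have [c c01 E] := MVT ltr01 (fun t ht => H t (subset_itv_oo_cc ht)) Hc.
exists c; first by move: (subset_itv_oo_cc c01); rewrite /= in_itv.
by move: E; rewrite scale1r scale0r addr0 subr0 mulr1 => <-; rewrite dotvDl dotvNl.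
Qed.

Lemma taylor2_upper (h dh : R -> R) (q : R) :
  (forall t : R, 0 <= t <= 1 -> is_derive t 1 h (dh t)) ->
  (forall t : R, 0 <= t <= 1 -> dh t <= dh 0 + q * t) ->
  h 1 <= h 0 + dh 0 + q / 2.
Proof.
move=> Hh Hd.
(* Subtracting the quadratic with derivative dh 0 + q t leaves a function with nonpositive
   derivative on [0, 1], so k 1 <= k 0. *)
pose k t := h t - (dh 0 * t + q / 2 * (t * t)).
have Hk (t : R) : t \in `[0, 1] -> is_derive t 1 k (dh t - (dh 0 + q * t)).
  rewrite in_itv /= => /Hh Ht.
  have Hid := is_derive_id t (1 : R).
  have := is_deriveB Ht (is_deriveD (is_deriveM (is_derive_cst (dh 0) t 1) Hid)
    (is_deriveM (is_derive_cst (q / 2) t 1) (is_deriveM Hid Hid))).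
  move=> Hk; apply: is_derive_eq Hk _.
  by rewrite /cst /= /GRing.scale /=; field.
have Hc : {within `[0, 1], continuous k}.
  by apply: is_derive1_continuous => u; rewrite inE /=; exact: Hk.
have [c c01 E] := MVT ltr01 (fun t ht => Hk t (subset_itv_oo_cc ht)) Hc.
have := Hd c; move: (subset_itv_oo_cc c01); rewrite /= in_itv /= => -> /(_ isT).
by move: E; rewrite /k; lra.
Qed.

(** The mean value form between [x] and [x + t *: d] bounds the growth of the slope along [d] by q
    t, which [taylor2_upper] turns into the term q / 2. *)
Lemma descent_lemma f x d (q : R) :
  (forall t : R, 0 <= t <= 1 -> differentiable f (x + t *: d)) ->
  (forall t : R, 0 <= t <= 1 -> differentiable (grad f) (x + t *: d)) ->
  (forall t : R, 0 <= t <= 1 -> dotv d (hess f (x + t *: d) *m d) <= q) ->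
  f (x + d) <= f x + dotv (grad f x) d + q / 2.
Proof.
move=> df dg Hq.
have := @taylor2_upper (fun t => f (x + t *: d))
  (fun t => dotv (grad f (x + t *: d)) d) q.
rewrite !scale1r !scale0r !addr0; apply.
  by move=> t /df; exact: is_derive_line.
move=> t /andP[t0 t1].
have sub c : 0 <= c <= 1 -> 0 <= c * t <= 1.
  by case/andP=> c0 c1; rewrite mulr_ge0 //= mulr_ile1.
have [|c c01] := @grad_mean_value f x (t *: d) d.
  by move=> c c01; rewrite scalerA; apply: dg; exact: sub.
rewrite dotvDl dotvNl scalerA -scalemxAr dotvZr -lerBlDl => ->.
by rewrite mulrC ler_wpM2r // Hq // sub.
Qed.

(** Difference quotients with small positive steps are nonnegative and converge to the directional
    derivative. *)
Lemma segment_minimizer_grad f x d :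
  differentiable f x ->
  (\forall t \near 0^'+, f x <= f (x + t *: d)) ->
  0 <= dotv (grad f x) d.
Proof.
move=> df Hmin; rewrite -derive_grad //.
have /cvg_ex [l Hl] : derivable f x d by exact: diff_derivable.
have -> : 'D_d f x = l by exact/cvg_lim.
have Hr : h^-1 *: ((f \o shift x) (h *: d) - f x) @[h --> 0^'+] --> l.
  move=> A /Hl /nbhs_ballP[e /= e0 sA]; exists e => //= h he h0.
  by apply: sA => //; rewrite gt_eqF.
have nneg : \forall h \near 0^'+,
    0 <= (h : R)^-1 *: ((f \o shift x) (h *: d) - f x).
  near=> h; have h0 : 0 < h by near: h; exact: nbhs_right_gt.
  rewrite mulr_ge0 ?invr_ge0 ?(ltW h0) // subr_ge0 /= addrC.
  by near: h; exact: Hmin.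
exact: (closed_cvg _ (@closed_ge R 0) nneg l Hr).
Unshelve. all: by end_near.
Qed.

End DirectionalDerivative.

(** * Passing between the full space and the coordinates in [T] *)

Lemma continuous_mulmx (R : realType) m n (A : 'M[R]_(n, m)) :
  continuous (fun w : 'cV[R]_m => A *m w).
Proof.
apply: continuous_mx => i j w; apply: differentiable_continuous.
have -> : (fun w : 'cV[R]_m => (A *m w) i j) =
    \sum_k (fun w : 'cV[R]_m => A i k * w k j).
  by apply/funext => u; rewrite mxE fct_sumE.
apply: differentiable_sum => k; apply: differentiableM => //.
exact: differentiable_coord.
Qed.

Section Coordinates.
Variables (R : realType) (n : nat) (T : {set 'I_n}).
Implicit Types (C : set 'cV[R]_n) (x : 'cV[R]_n) (v w : 'cV[R]_#|T|).

Lemma restr_embed w : restr T (embed R T *m w) = w.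
Proof.
rewrite /restr mulmxA (_ : _ *m _ = 1%:M) ?mul1mx //.
apply/matrixP => i j; rewrite !mxE (bigD1 (enum_val i)) //= !mxE eqxx mul1r.
rewrite big1 ?addr0 => [|k ki]; last by rewrite !mxE (negbTE ki) mul0r.
by rewrite (inj_eq enum_val_inj).
Qed.

Lemma embedE w i (iT : i \in T) :
  (embed R T *m w) i ord0 = w (enum_rank_in iT i) ord0.
Proof.
rewrite mxE (bigD1 (enum_rank_in iT i)) //= !mxE enum_rankK_in // eqxx mul1r.
rewrite big1 ?addr0 // => k ki; rewrite !mxE; case: eqP => [ik|_]; last exact: mul0r.
by move: ki; rewrite [X in _ != enum_rank_in _ X]ik enum_valK_in eqxx.
Qed.

Lemma supp_embed w : supp (embed R T *m w) \subset T.
Proof.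
apply/fintype.subsetP => i; rewrite inE; apply: contra_neqT => iT.
rewrite mxE big1 // => k _; rewrite !mxE; case: eqP => [ik|_]; last exact: mul0r.
by case/negP: iT; rewrite ik enum_valP.
Qed.

Lemma embed_restr x : supp x \subset T -> embed R T *m restr T x = x.
Proof.
move=> /fintype.subsetP sx; apply/colP => i.
have [iT|iT] := boolP (i \in T).
  rewrite embedE mxE (bigD1 i) //= !mxE enum_rankK_in // eqxx mul1r.
  by rewrite big1 ?addr0 // => k /negbTE ki; rewrite !mxE enum_rankK_in // ki mul0r.
have /eqP -> : x i ord0 == 0.
  by apply: contraNT iT => xi; apply: sx; rewrite inE.
apply/eqP; move: iT; apply: contraNT => xi.
by apply: (fintype.subsetP (supp_embed (restr T x))); rewrite inE.
Qed.

(** The columns of [embed R T] are orthonormal; distances can thus be compared in the coordinates of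
    [T]. *)
Lemma dotv_embed v w : dotv (embed R T *m v) (embed R T *m w) = dotv v w.
Proof. by rewrite dotv_mulmx -/(restr T _) restr_embed. Qed.

Lemma set_restr_closed C : closed C -> closed (set_restr T C).
Proof.
move=> Ccl; apply: (@preimage_closed _ _ (fun w => embed R T *m w)) => // w _.
exact: continuous_mulmx.
Qed.

Lemma set_restr_segment_closed C :
  segment_closed C -> segment_closed (set_restr T C).
Proof.
move=> sC v w t Cv Cw t01.
by rewrite /set_restr /= mulmxDr -scalemxAr mulmxBr; exact: sC.
Qed.

End Coordinates.

(** * Consequences of the restricted Hessian bounds *)

Lemma dotv_mx_sym (R : realType) m (A : 'M[R]_m) (u v : 'cV[R]_m) :
  A^T = A -> dotv u (A *m v) = dotv v (A *m u).
Proof. by move=> sA; rewrite dotvC dotv_mulmx sA. Qed.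

Lemma psd_dotv (R : realType) m (A : 'M[R]_m) (v : 'cV[R]_m) :
  psd A -> 0 <= dotv v (A *m v).
Proof. by case=> _ /(_ v); rewrite /dotv mulmxA. Qed.

Section RestrictedGradient.
Variables (R : realType) (n : nat) (T : {set 'I_n}) (f : 'cV[R]_n -> R).
Variables (mu L : R) (mu_gt0 : 0 < mu) (L_gt0 : 0 < L).
Let U := embed R T.

Lemma dotv_hess_restr (x : 'cV[R]_n) (u v : 'cV[R]_#|T|) :
  dotv (U *m u) (hess f x *m (U *m v)) = dotv u (hess_restr T f x *m v).
Proof. by rewrite dotv_mulmx /hess_restr !mulmxA. Qed.

Lemma gradient_step_nonexpansive (x : 'cV[R]_n) (d : 'cV[R]_#|T|) :
  (forall t : R, 0 <= t <= 1 -> differentiable (grad f) (x + t *: (U *m d))) ->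
  (forall t : R, 0 <= t <= 1 ->
     let H := hess_restr T f (x + t *: (U *m d)) in
     loewner mu%:M H /\ loewner H L%:M) ->
  enorm (d - L^-1 *: (restr T (grad f (x + U *m d)) - restr T (grad f x)))
    <= enorm d.
Proof.
move=> dg Hb; rewrite ler_enorm; set D := _ - restr T _; set e := d - _.
(* The mean value theorem holds only for scalar functions, so it is applied to the
   component of the gradient along [e] itself: [L |e|^2 = <e, (L I - H) d>] for the Hessian
   [H] at one intermediate point, and [0 <= L I - H <= L I] concludes. *)
have [c c01] := grad_mean_value (U *m e) dg.
have [[sH0 Hmu] pL] := Hb c c01.
rewrite dotv_hess_restr; set H := hess_restr T f _ in sH0 Hmu pL *.
have -> : dotv (grad f (x + U *m d) - grad f x) (U *m e) = dotv e D.
  by rewrite dotvC dotv_mulmx mulmxBr.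
move=> eD.
have sH : H^T = H.
  by move: sH0; rewrite linearB /= tr_scalar_mx => /addIr.
have He := psd_dotv e (conj sH0 Hmu).
have Hd := psd_dotv d (conj sH0 Hmu).
(* With A = L I - H, positivity at e - d gives 2 <e, A d> <= <e, A e> + <d, A d> <= L |e|^2 + L
   |d|^2, and the left side equals 2 L |e|^2 by [Le]. *)
have Hde := psd_dotv (e - d) pL.
have Le : L * dotv e e = L * dotv e d - dotv e (H *m d).
  have -> : dotv e e = dotv e d - L^-1 * dotv e D.
    by rewrite -dotvZr -dotvNr -dotvDr.
  by rewrite eD mulrBr mulrA divff ?gt_eqF // mul1r.
have mue := mulr_ge0 (ltW mu_gt0) (dotv_ge0 e).
have mud := mulr_ge0 (ltW mu_gt0) (dotv_ge0 d).
move: He Hd Hde Le mue; clearbody e H; rewrite !mulmxBl !mul_scalar_mx mulmxBr.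
rewrite !dotv_lin (dotvC d e) (dotv_mx_sym d e sH) => He Hd Hde Le mue.
by rewrite -(ler_pM2l L_gt0); lra.
Qed.

Lemma restricted_descent (x : 'cV[R]_n) (d : 'cV[R]_#|T|) :
  (forall t : R, 0 <= t <= 1 -> differentiable f (x + t *: (U *m d))) ->
  (forall t : R, 0 <= t <= 1 -> differentiable (grad f) (x + t *: (U *m d))) ->
  (forall t : R, 0 <= t <= 1 ->
     loewner (hess_restr T f (x + t *: (U *m d))) L%:M) ->
  f (x + U *m d) <=
    f x + dotv (restr T (grad f x)) d + L * dotv d d / 2.
Proof.
move=> df dg Hb.
have -> : dotv (restr T (grad f x)) d = dotv (grad f x) (U *m d).
  by rewrite dotv_mulmx trmxK.
apply: descent_lemma => // t /Hb pL; rewrite dotv_hess_restr.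
have := psd_dotv d pL.
by rewrite mulmxBl mul_scalar_mx !dotv_lin subr_ge0.
Qed.

End RestrictedGradient.

(** * Decrease of the projected gradient step near the minimizer *)

Lemma dotv_segment_le (R : realType) m (u v : 'cV[R]_m) (t r : R) :
  0 <= t <= 1 -> dotv u u <= r -> dotv v v <= r ->
  dotv (u + t *: (v - u)) (u + t *: (v - u)) <= r.
Proof.
move=> /andP[t0 t1] ur vr.
(* Convexity of the squared norm with its exact defect, the last term. *)
have : dotv (u + t *: (v - u)) (u + t *: (v - u)) =
    (1 - t) * dotv u u + t * dotv v v - t * (1 - t) * dotv (v - u) (v - u).
  by rewrite !dotv_lin (dotvC v u); ring.
have t10 : 0 <= 1 - t by rewrite subr_ge0.
have := mulr_ge0 (mulr_ge0 t0 t10) (dotv_ge0 (v - u)).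
have := ler_wpM2l t0 vr; have := ler_wpM2l t10 ur; lra.
Qed.

(** A short move from [xs] towards the embedded [w] stays in [C] by convexity and keeps its support
    in [T], so local minimality makes the slope nonnegative. *)
Lemma restricted_first_order (R : realType) n (C : set 'cV[R]_n)
    (f : 'cV[R]_n -> R) (xs : 'cV[R]_n) (T : {set 'I_n}) (w : 'cV[R]_#|T|) :
  segment_closed C -> differentiable f xs -> C xs -> supp xs \subset T ->
  (\forall x \near xs, supported_in C T x -> f xs <= f x) ->
  set_restr T C w -> 0 <= dotv (restr T (grad f xs)) (w - restr T xs).
Proof.
move=> sC df Cxs sxs xs_min Cw.
rewrite dotv_mulmx trmxK mulmxBr embed_restr //.
set y := embed R T *m w in Cw *.
have seg : xs + t *: (y - xs) @[t --> (0 : R)^'+] --> xs.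
  apply: cvg_at_right_filter.
  have -> : nbhs xs = nbhs (xs + (0 : R) *: (y - xs)) by rewrite scale0r addr0.
  apply: cvgD; first exact: cvg_cst.
  exact: scalel_continuous.
apply: segment_minimizer_grad => //.
near=> t.
have t0 : 0 < t by near: t; exact: nbhs_right_gt.
have t1 : t <= 1 by near: t; exact: nbhs_right_le.
have : supported_in C T (xs + t *: (y - xs)).
  split; first by apply: sC => //; rewrite (ltW t0).
  rewrite -(embed_restr sxs) -mulmxBr scalemxAr -mulmxDr; exact: supp_embed.
by near: t; exact: seg xs_min.
Unshelve. all: by end_near. Qed.

Section ProjectedGradientStep.
Variables (R : realType) (n : nat) (C : set 'cV[R]_n) (f : 'cV[R]_n -> R).
Variables (xs : 'cV[R]_n) (N : set 'cV[R]_n) (mu L : R).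
Hypotheses (C_closed : closed C) (C_convex : convex_set C) (f_C1 : C1 f).
Hypotheses (C_xs : C xs) (N_ball : ball_nbhd xs N).
Hypothesis xs_min :
  \forall x \near xs, supported_in C (supp xs) x -> f xs <= f x.
Hypotheses (mu_gt0 : 0 < mu) (mu_le_L : mu <= L) (f_C2 : C2_on N f).
Hypothesis hess_bounds : forall x, N x -> supp x \subset supp xs ->
  loewner mu%:M (hess_restr (supp xs) f x) /\
  loewner (hess_restr (supp xs) f x) L%:M.

Let T := supp xs.
Let U := embed R T.

Let U_xs : U *m restr T xs = xs.
Proof. exact: embed_restr. Qed.

Let C_segment : segment_closed C := segment_closed_convex C_convex.

(** The ball property of [N], read in the coordinates of [T] through the isometry [embed R T]. *)
Lemma nbhd_near_embed x (w : 'cV[R]_#|T|) : N x -> supp x \subset T ->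
  dotv (w - restr T xs) (w - restr T xs) <=
    dotv (restr T x - restr T xs) (restr T x - restr T xs) ->
  N (U *m w).
Proof.
move=> Nx sx wx; apply: (N_ball.2 x) => //.
have -> : U *m w - xs = U *m (w - restr T xs) by rewrite mulmxBr U_xs.
have -> : x - xs = U *m (restr T x - restr T xs).
  by rewrite mulmxBr U_xs embed_restr.
by rewrite ler_enorm !dotv_embed.
Qed.

Lemma pg_step_decrease x : C x -> N x -> supp x \subset T ->
  f (U *m pg_step C f L T x) <= f x - enorm (pg_map C f L T x) ^+ 2 / (2 * L).
Proof.
move=> Cx Nx sx.
have L_gt0 : 0 < L := lt_le_trans mu_gt0 mu_le_L.
have Ux := embed_restr sx; have Uws := U_xs.
set w := restr T x in Ux; set ws := restr T xs in Uws; set p := pg_step C f L T x.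
set g := restr T (grad f x); set gs := restr T (grad f xs).
have CTw : set_restr T C w by rewrite /set_restr /= Ux.
have CTws : set_restr T C ws by rewrite /set_restr /= Uws.
have np : nearest (set_restr T C) (w - L^-1 *: g) p.
  by apply: proj_nearest; [exact: set_restr_closed | exists w].
(* Used twice: z = ws locates the step [p], and z = w yields the decrease. *)
have var z := @nearest_variational _ _ _ _ _ z (set_restr_segment_closed C_segment) np.
have opt : 0 <= dotv gs (p - ws).
  exact: (restricted_first_order C_segment (f_C1.1 xs) C_xs (subxx _) xs_min (proj1 np)).
(* [w] and [z] lie in the ball about [ws] of radius |w - ws|, hence so does the segment joining
   them. For z = p this is the path of the step. *)
have bdN t z : 0 <= t <= 1 ->
    dotv (z - ws) (z - ws) <= dotv (w - ws) (w - ws) ->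
    N (x + t *: (U *m (z - w))).
  move=> t01 zw.
  rewrite -Ux scalemxAr -mulmxDr; apply: (nbhd_near_embed Nx sx).
  rewrite -/w -/ws addrAC -[z - w](subrKA ws) -[ws - w]opprB.
  exact: dotv_segment_le.
have p_near : dotv (p - ws) (p - ws) <= dotv (w - ws) (w - ws).
  have seg (t : R) : 0 <= t <= 1 -> N (xs + t *: (U *m (w - ws))) /\
      supp (xs + t *: (U *m (w - ws))) \subset T.
    move=> /andP[t0 t1].
    have -> : xs + t *: (U *m (w - ws)) = U *m (ws + t *: (w - ws)).
      by rewrite [RHS]mulmxDr Uws scalemxAr.
    rewrite supp_embed; split => //.
    apply: (nbhd_near_embed Nx sx); rewrite -/w -/ws addrC addKr dotvZl dotvZr mulrA.
    by rewrite ler_piMl ?dotv_ge0 // mulr_ile1.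
  have step : enorm (w - ws - L^-1 *: (g - gs)) <= enorm (w - ws).
    have Uxs : xs + U *m (w - ws) = x by rewrite mulmxBr Ux Uws addrC subrK.
    rewrite /g -[in grad f x]Uxs.
    apply: (gradient_step_nonexpansive mu_gt0 L_gt0) => t t01.
      by apply: f_C2.1; exact: (seg t t01).1.
    by apply: hess_bounds; [exact: (seg t t01).1 | exact: (seg t t01).2].
  move: step; rewrite ler_enorm; apply: le_trans.
  (* Put b = p - ws, a = w - g / L - p and v = gs / L. The vector on the right is b + (a + v), and
     |b + a + v|^2 >= |b|^2 + 2 <a, b> + 2 <v, b>. Here <a, b> >= 0 by the variational inequality at
     [ws], and <v, b> >= 0 by [opt]. *)
  have := var ws CTws; have := dotv_ge0 (w - L^-1 *: g - p + L^-1 *: gs).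
  have Li : 0 <= L^-1 by rewrite invr_ge0 ltW.
  have := mulr_ge0 Li opt.
  have -> : w - ws - L^-1 *: (g - gs) =
    (p - ws) + ((w - L^-1 *: g - p) + L^-1 *: gs).
    have E (a b c u v : 'cV[R]_#|T|) :
      a - b + (v - u) = (c - b) + ((a - u - c) + v).
      by apply/colP => i; rewrite !mxE; ring.
    by rewrite scalerBr opprB.
  rewrite -[ws - p]opprB.
  move: (w - _ - p) (p - ws) => a b; rewrite !dotv_lin (dotvC a b) (dotvC gs b).
  lra.
have descent : f (U *m p) <= f x + dotv g (p - w) + L * dotv (p - w) (p - w) / 2.
  have -> : U *m p = x + U *m (p - w) by rewrite mulmxBr Ux addrC subrK.
  apply: restricted_descent => [t t01|t t01|t t01].
  - exact: f_C1.1.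
  - by apply: f_C2.1; exact: bdN.
  - apply: (hess_bounds _ _).2; first exact: bdN.
    by rewrite -Ux scalemxAr -mulmxDr supp_embed.
(* With d = p - w this reads |d|^2 + <g, d> / L <= 0. Inserted in [descent], it leaves a decrease of
   at least L |d|^2 / 2, which is |G|^2 / (2 L) for G = - L d. *)
have := var w CTw; rewrite /pg_map -/w -/p enorm_sqr.
rewrite addrAC -[w - p]opprB; move: (p - w) descent => d descent.
rewrite !dotv_lin => vard.
have {}vard : dotv d d + L^-1 * dotv g d <= 0 by move: vard; lra.
have gd : dotv g d <= - (L * dotv d d).
  have := ler_wpM2l (ltW L_gt0) vard.
  by rewrite mulr0 mulrDr mulrA divff ?gt_eqF // mul1r; lra.
have -> : L * (L * - - dotv d d) / (2 * L) = L * dotv d d / 2.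
  by field; rewrite gt_eqF.
by move: descent gd; lra.
Qed.

End ProjectedGradientStep.

(** * Linear rate along a run of the algorithm *)

Theorem theorem4 (R : realType) (n s : nat) (ty : symmetry_type)
  (C : set 'cV[R]_n) (f : 'cV[R]_n -> R)
  (C_closed : closed C) (C_convex : convex_set C) (C_sym : symmetric_set ty C)
  (f_C1 : C1 f)
  (f_lip : forall B : set 'cV[R]_n, B `<=` C -> bounded_set B ->
     [lipschitz grad f x | x in B])
  (* the limit point and its neighborhood *)
  (xs : 'cV[R]_n) (xs_feas : sparse_feasible C s xs)
  (xs_min : \forall x \near xs, supported_in C (supp xs) x -> f xs <= f x)
  (N : set 'cV[R]_n) (N_ball : ball_nbhd xs N)
  (mu L mupg : R) (mu_gt0 : 0 < mu) (mu_le_L : mu <= L) (mupg_gt0 : 0 < mupg)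
  (* (a) *)
  (f_C2 : C2_on N f)
  (hess_bounds : forall x, N x -> supp x \subset supp xs ->
     loewner mu%:M (hess_restr (supp xs) f x) /\
     loewner (hess_restr (supp xs) f x) L%:M)
  (* (b) *)
  (pg_error_bound : forall x, N x -> supp x \subset supp xs ->
     2 * mupg * (f x - f xs) <= enorm (pg_map C f L (supp xs) x) ^+ 2)
  (* (c) *)
  (N_small : forall x, N x -> supported_in C (supp xs) x -> f xs <= f x)
  (* the run of the algorithm *)
  (pr : rzcw_params R) (tr : rzcw_trace R n)
  (run : rzcw_pss ty s C f pr tr)
  (start_card : norm0 (iter_ tr 0) = s)
  (start_alpha : forall i, i \in supp (iter_ tr 0) ->
     alpha pr <= `|iter_ tr 0 i ord0|)
  (* eventual support, eventual location *)
  (card_supp : #|supp xs| = s)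
  (k1 : nat) (supp_stable : forall k, (k1 <= k)%N ->
     supp (iter_ tr k) = supp xs /\
     forall i, i \in supp xs -> alpha pr <= `|iter_ tr k i ord0|)
  (k0 : nat) (in_N : forall k, (k0 <= k)%N -> N (iter_ tr k))
  (* approximate minimization over the whole candidate set *)
  (eta : R) (eta_gt0 : 0 < eta) (eta_lt1 : eta < 1)
  (near_best : forall k, f (iter_ tr k.+1) <= cand_min f tr k + xi pr k)
  (xi_small : forall k, xi pr k <= eta * (f (iter_ tr k) - cand_min f tr k))
  (* local candidate richness *)
  (k2 : nat) (rich : forall k, (k2 <= k)%N ->
     exists2 xbar, xbar \in candidates tr k &
       f xbar <= f (embed R (supp xs) *m pg_step C f L (supp xs) (iter_ tr k))) :
  exists rho : R,
    [/\ rho = Num.min (1 / 2) ((1 - eta) * mupg / L),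
        0 < rho < 1 &
        forall k, (maxn k0 (maxn k1 k2) <= k)%N ->
          f (iter_ tr k.+1) - f xs <= (1 - rho) * (f (iter_ tr k) - f xs)].
Proof.
have L_gt0 : 0 < L := lt_le_trans mu_gt0 mu_le_L.
have rate_gt0 : 0 < (1 - eta) * mupg / L.
  by rewrite divr_gt0 // mulr_gt0 // subr_gt0.
exists (Num.min (1 / 2) ((1 - eta) * mupg / L)); split=> //.
  (* The entry 1 / 2 of the minimum keeps the rate below 1. *)
  rewrite lt_min rate_gt0 divr_gt0 //= gt_min; apply/orP; left; lra.
move=> k; rewrite !geq_max => /and3P[k0k k1k k2k].
set x := iter_ tr k; set rho := Num.min _ _.
have Nx : N x by exact: in_N.
have sx : supp x \subset supp xs by rewrite (supp_stable _ k1k).1.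
have [_ _ _ feas _] := run.
have Cx : C x by apply: (feas k x _).1; left; rewrite /candidates mem_head.
have [xbar xbar_cand fxbar] := rich _ k2k.
have cand_le : cand_min f tr k <= f xbar by exact: ge_bigmin_seq.
have dec := pg_step_decrease C_closed C_convex f_C1 xs_feas.1 N_ball xs_min
  mu_gt0 mu_le_L f_C2 hess_bounds Cx Nx sx.
have gap_ge0 : 0 <= f x - f xs by rewrite subr_ge0 N_small.
(* The error bound divided by 2 L, chained with the decrease at the projected gradient step and the
   candidate [xbar] that does at least as well. *)
have cand_dec : mupg / L * (f x - f xs) <= f x - cand_min f tr k.
  have := pg_error_bound _ Nx sx.
  rewrite -(ler_pM2r (_ : 0 < (2 * L)^-1)) ?invr_gt0 ?mulr_gt0 //.
  have -> : 2 * mupg * (f x - f xs) / (2 * L) = mupg / L * (f x - f xs).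
    by field; rewrite gt_eqF.
  by move: dec fxbar cand_le; rewrite -/x; lra.
have rho_le : rho * (f x - f xs) <= (1 - eta) * mupg / L * (f x - f xs).
  by rewrite ler_wpM2r // ge_min lexx orbT.
have eta1 : 0 <= 1 - eta by rewrite subr_ge0 ltW.
(* With m the candidate minimum, the next value is at most m + eta (f x - m), so the decrease is at
   least (1 - eta) (f x - m), hence at least [rho] times the gap. *)
have := ler_wpM2l eta1 cand_dec.
rewrite !mulrA => dec_eta.
have := near_best k; have := xi_small k; rewrite -/x.
lra.
Qed.
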